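(* A universe of separations $\vec U$ can be strongly implemented by bipartitions of sets if and only if it is distributive and fastidious.
   Context: A separation system is a poset with an order-reversing involution $\vec s\mapsto\vec s^{\,*}$; a universe of separations is a separation system which is a lattice, with join $\vee$ and meet $\wedge$; it is distributive if this lattice is distributive. An element $\vec s$ is small if $\vec s\le\vec s^{\,*}$. A separation system is fastidious if $\vec s\le\vec t$ for every small $\vec s$ and every element $\vec t$. A homomorphism of universes is a map commuting with the involutions, joins and meets; an isomorphism of universes is a bijective homomorphism whose inverse is a homomorphism. For a set $V$, $\mathcal{U}(V)$ is the universe of all pairs $(A,B)$ of subsets of $V$ with $A\cup B=V$, with involution $(A,B)^*=(B,A)$, order $(A,B)\le(C,D)$ iff $A\subseteq C$ and $D\subseteq B$, join $(A\cup C,B\cap D)$ and meet $(A\cap C,B\cup D)$. $\mathcal{UB}(V)$ is the sub-universe of $\mathcal{U}(V)$ consisting of all $(A,B)$ with $A\cap B=\emptyset$ (the empty set is allowed as a side). A sub-universe is a subset closed under involution, join and meet. $\vec U$ can be strongly implemented by bipartitions if there are a set $V$ and a sub-universe of $\mathcal{UB}(V)$ isomorphic (as a universe) to $\vec U$. *)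

(* Defs.v *)
From HB Require Import structures.
From mathcomp Require Import all_boot all_order.
From mathcomp Require Import boolp classical_sets.

Set Implicit Arguments.
Unset Strict Implicit.
Unset Printing Implicit Defensive.

Import Order.TTheory.
Local Open Scope order_scope.

Reserved Notation "s ^*" (at level 1, left associativity, format "s ^*").

HB.mixin Record isSepSystem (d : Order.disp_t) T of Order.POrder d T := {
  sepinv : T -> T;
  sepinvK : involutive sepinv;
  le_sepinv : forall s t : T, s <= t -> sepinv t <= sepinv s
}.

#[short(type="sepSystemType")]
HB.structure Definition SepSystem d :=
  {T of Order.POrder d T & isSepSystem d T}.

#[short(type="sepUniverseType")]
HB.structure Definition SepUniverse d :=
  {T of Order.Lattice d T & isSepSystem d T}.

Notation "s ^*" := (sepinv s) : order_scope.

Definition small d (S : sepSystemType d) (s : S) : Prop := s <= s^*.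

Definition fastidious d (S : sepSystemType d) : Prop :=
  forall s : S, small s -> forall t : S, s <= t.

(* As opposed to the structure distrLatticeType, a property of a given lattice;
   the dual law follows. *)
Definition distributive d (L : latticeType d) : Prop :=
  left_distributive (@Order.meet d L) (@Order.join d L).

Definition universe_hom d d' (U : sepUniverseType d) (W : sepUniverseType d')
    (f : U -> W) : Prop :=
  [/\ {morph f : s / s^*},
      {morph f : s t / s `|` t}
    & {morph f : s t / s `&` t}].

Definition universe_isomorphic d d' (U : sepUniverseType d)
    (W : sepUniverseType d') : Prop :=
  exists (f : U -> W) (g : W -> U),
    [/\ cancel f g, cancel g f, universe_hom f & universe_hom g].

HB.mixin Record isSepinvClosed d (U : sepUniverseType d) (S : {pred U}) := {
  sepinv_closed : forall s : U, s \in S -> s^* \in S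
}.

#[short(type="subUniverse")]
HB.structure Definition SubUniverse d (U : sepUniverseType d) :=
  {S of @Order.LatticeClosed d U S & isSepinvClosed d U S}.

Section SubUniverseType.
Context d (U : sepUniverseType d) (S : subUniverse U).

Record sub_universe := SubUniverseElt {
  sub_universe_val : U;
  _ : sub_universe_val \in S
}.

HB.instance Definition _ := [isSub for sub_universe_val].
HB.instance Definition _ := [Choice of sub_universe by <:].
HB.instance Definition _ :=
  Order.SubChoice_isSubLattice.Build d U (fun x => x \in S) d sub_universe
    (@Order.opredI d U S) (@Order.opredU d U S).

Definition sub_sepinv (s : sub_universe) : sub_universe :=
  SubUniverseElt (sepinv_closed _ (valP s)).

Lemma sub_sepinvK : involutive sub_sepinv.
Proof. by move=> s; apply: val_inj; rewrite /= sepinvK. Qed.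

Lemma le_sub_sepinv (s t : sub_universe) :
  s <= t -> sub_sepinv t <= sub_sepinv s.
Proof. by rewrite -!Order.le_val; exact: le_sepinv. Qed.

HB.instance Definition _ :=
  isSepSystem.Build d sub_universe sub_sepinvK le_sub_sepinv.

End SubUniverseType.

(* setsep V is U(V): the pairs (A, B) of subsets of V with A `|` B = V. *)
Section SetSeparations.
Context (V : Type).

Record setsep := SetSep {
  sides : set V * set V;
  _ : `[< (sides.1 `|` sides.2 = [set: V])%classic >]
}.

HB.instance Definition _ := [isSub for sides].
HB.instance Definition _ := [Choice of setsep by <:].

Implicit Types s t u : setsep.

Lemma sidesP s : ((sides s).1 `|` (sides s).2 = [set: V])%classic.
Proof. by case: s => ? /= /asboolP. Qed.

Definition setsep_le s t : bool :=
  `[< ((sides s).1 `<=` (sides t).1)%classic /\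
      ((sides t).2 `<=` (sides s).2)%classic >].

Lemma setsep_inv_subproof s :
  `[< ((sides s).2 `|` (sides s).1 = [set: V])%classic >].
Proof. by apply/asboolP; rewrite setUC sidesP. Qed.

Definition setsep_inv s : setsep :=
  SetSep (sides := ((sides s).2, (sides s).1)) (setsep_inv_subproof s).

Lemma setsep_join_subproof s t :
  `[< (((sides s).1 `|` (sides t).1) `|` ((sides s).2 `&` (sides t).2)
      = [set: V])%classic >].
Proof.
apply/asboolP; rewrite -subTset => x _.
have : ((sides s).1 `|` (sides s).2)%classic x by rewrite sidesP.
have : ((sides t).1 `|` (sides t).2)%classic x by rewrite sidesP.
by move=> [xt|xt] [xs|xs]; [left; left|left; right|left; left|right].
Qed.

Definition setsep_join s t : setsep :=
  SetSep (sides := (((sides s).1 `|` (sides t).1)%classic,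
                    ((sides s).2 `&` (sides t).2)%classic))
         (setsep_join_subproof s t).

Lemma setsep_meet_subproof s t :
  `[< (((sides s).1 `&` (sides t).1) `|` ((sides s).2 `|` (sides t).2)
      = [set: V])%classic >].
Proof.
apply/asboolP; rewrite setUC.
exact: (asboolW (setsep_join_subproof (setsep_inv s) (setsep_inv t))).
Qed.

Definition setsep_meet s t : setsep :=
  SetSep (sides := (((sides s).1 `&` (sides t).1)%classic,
                    ((sides s).2 `|` (sides t).2)%classic))
         (setsep_meet_subproof s t).

Lemma setsep_le_refl : reflexive setsep_le.
Proof. by move=> s; apply/asboolP; split; exact: subset_refl. Qed.

Lemma setsep_le_anti : antisymmetric setsep_le.
Proof.
move=> s t /andP[/asboolP[s1 s2] /asboolP[t1 t2]]; apply: val_inj => /=.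
rewrite [sides s]surjective_pairing [sides t]surjective_pairing.
by congr pair; apply/seteqP.
Qed.

Lemma setsep_le_trans : transitive setsep_le.
Proof.
move=> t s u /asboolP[s1 s2] /asboolP[t1 t2]; apply/asboolP; split.
- exact: subset_trans s1 t1.
- exact: subset_trans t2 s2.
Qed.

Fact setsep_display : Order.disp_t. Proof. exact: (Order.Disp tt tt). Qed.

HB.instance Definition _ := Order.Le_isPOrder.Build setsep_display setsep
  setsep_le_refl setsep_le_anti setsep_le_trans.

Lemma setsep_meetP s t u :
  (s <= setsep_meet t u) = (s <= t) && (s <= u).
Proof.
apply/idP/andP => [/asboolP|[/asboolP[t1 t2] /asboolP[u1 u2]]].
- by rewrite /= subsetI subUset => -[[? ?] [? ?]]; split; apply/asboolP.
- by apply/asboolP; rewrite /= subsetI subUset.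
Qed.

Lemma setsep_joinP s t u :
  (setsep_join s t <= u) = (s <= u) && (t <= u).
Proof.
apply/idP/andP => [/asboolP|[/asboolP[s1 s2] /asboolP[t1 t2]]].
- by rewrite /= subsetI subUset => -[[? ?] [? ?]]; split; apply/asboolP.
- by apply/asboolP; rewrite /= subsetI subUset.
Qed.

HB.instance Definition _ := Order.POrder_MeetJoin_isLattice.Build
  setsep_display setsep setsep_meetP setsep_joinP.

Lemma setsep_invK : involutive setsep_inv.
Proof. by move=> s; apply: val_inj => /=; rewrite -surjective_pairing. Qed.

Lemma le_setsep_inv s t : s <= t -> setsep_inv t <= setsep_inv s.
Proof. by move=> /asboolP[s1 s2]; apply/asboolP. Qed.

HB.instance Definition _ := isSepSystem.Build setsep_display setsep
  setsep_invK le_setsep_inv.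

(* The carrier of UB(V) in U(V); a side may be empty. *)
Definition bipartitions : {pred setsep} :=
  fun s => `[< ((sides s).1 `&` (sides s).2 = set0)%classic >].

Lemma bipartitions_inv_closed s : s \in bipartitions -> s^* \in bipartitions.
Proof. by move=> /asboolP s0; apply/asboolP; rewrite /= setIC. Qed.

Lemma bipartitions_join_closed :
  {in bipartitions &, forall s t, s `|` t \in bipartitions}.
Proof.
move=> s t /asboolP s0 /asboolP t0; apply/asboolP.
rewrite -subset0 => x /= [[xs|xt] [xs' xt']].
- by rewrite -[False]/(set0 x) -s0.
- by rewrite -[False]/(set0 x) -t0.
Qed.

Lemma bipartitions_meet_closed :
  {in bipartitions &, forall s t, s `&` t \in bipartitions}.
Proof.
move=> s t /asboolP s0 /asboolP t0; apply/asboolP.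
rewrite -subset0 => x /= [[xs xt] [xs'|xt']].
- by rewrite -[False]/(set0 x) -s0.
- by rewrite -[False]/(set0 x) -t0.
Qed.

HB.instance Definition _ := Order.isLatticeClosed.Build setsep_display setsep
  bipartitions bipartitions_meet_closed bipartitions_join_closed.
HB.instance Definition _ := isSepinvClosed.Build setsep_display setsep
  bipartitions bipartitions_inv_closed.

End SetSeparations.

Arguments bipartitions V : clear implicits.

Notation UB V := (sub_universe (bipartitions V)).

Definition strongly_implementable_by_bipartitions d
    (U : sepUniverseType d) : Prop :=
  exists (V : Type) (S : subUniverse (UB V)),
    universe_isomorphic (sub_universe S) U.

(* Main.v *)
(* In a fastidious universe every [s `&` s^*] is small, hence a bottom element,
   and dually every [s `|` s^*] is a top element; so the distributive fastidious
   universes are exactly the Boolean algebras with [s^*] as complement (and the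
   empty universe).  Such a universe embeds into the bipartitions of its set of
   two-valued homomorphisms as in Stone's representation theorem, Zorn's lemma
   providing enough of them to separate elements. *)
Require Import Defs.
From HB Require Import structures.
From mathcomp Require Import all_boot all_order.
From mathcomp Require Import boolp classical_sets.

Set Implicit Arguments.
Unset Strict Implicit.
Unset Printing Implicit Defensive.

Import Order.TTheory.
Local Open Scope order_scope.

Section SeparationUniverses.
Context (d : Order.disp_t) (U : sepUniverseType d).
Implicit Types s t u : U.

Lemma le_sepinvl s t : (s^* <= t) = (t^* <= s).
Proof. by apply/idP/idP => /le_sepinv; rewrite sepinvK. Qed.

Lemma le_sepinvr s t : (s <= t^*) = (t <= s^*).
Proof. by rewrite -[X in X <= _]sepinvK le_sepinvl sepinvK. Qed.

Lemma sepinv_join s t : (s `|` t)^* = s^* `&` t^*.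
Proof.
apply/eqP; rewrite eq_le lexI !le_sepinv ?leUl ?leUr //= le_sepinvr leUx.
by rewrite !(le_sepinvr _ (_ `&` _)) leIl leIr.
Qed.

Lemma sepinv_meet s t : (s `&` t)^* = s^* `|` t^*.
Proof. by rewrite -[s]sepinvK -[t]sepinvK -sepinv_join !sepinvK. Qed.

Lemma small_meet_sepinv s : small (s `&` s^*).
Proof. by rewrite /small sepinv_meet sepinvK leIxl // leUr. Qed.

(** Up to isomorphism, [bool] with negation as involution is the universe of bipartitions of a
    single point. *)
Definition two_valued_hom (f : U -> bool) : Prop :=
  [/\ {morph f : s / s^* >-> ~~ s}, {morph f : s t / s `|` t >-> s || t}
    & {morph f : s t / s `&` t >-> s && t}].

Section Separation.
Hypotheses (distU : distributive U) (fastU : fastidious U).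

Lemma meet_sepinv_le s t : s `&` s^* <= t.
Proof. exact/fastU/small_meet_sepinv. Qed.

Lemma le_join_sepinv s t : t <= s `|` s^*.
Proof. by rewrite -[t]sepinvK le_sepinvl sepinv_join meet_sepinv_le. Qed.

(* The empty set is admitted so that Zorn's lemma applies to the empty chain. *)
Definition filter_avoiding s t (F : set U) : Prop :=
  [/\ forall x y, F x -> F y -> F (x `&` y), forall x y, x <= y -> F x -> F y,
      ~ F t & forall x, F x -> F s].

Lemma filter_avoiding_bigcup s t (C : set (set U)) :
  (C `<=` filter_avoiding s t)%classic -> total_on C subset ->
  filter_avoiding s t (\bigcup_(F in C) F)%classic.
Proof.
move=> sC totC; split.
- move=> x y [F CF Fx] [G CG Gy].
  have [FG|GF] := totC _ _ CF CG.
  + by exists G => //; have [GI _ _ _] := sC _ CG; apply: GI => //; exact: FG.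
  + by exists F => //; have [FI _ _ _] := sC _ CF; apply: FI => //; exact: GF.
- move=> x y xy [F CF Fx]; exists F => //.
  by have [_ FS _ _] := sC _ CF; exact: FS Fx.
- by move=> [F CF Ft]; have [_ _ + _] := sC _ CF.
- by move=> x [F CF Fx]; exists F => //; have [_ _ _ /(_ x)] := sC _ CF; exact.
Qed.

(** A maximal [F] satisfying [filter_avoiding s t] contains exactly one of [x] and [x^*] for each
    [x], so its indicator function is the required homomorphism. *)
Lemma two_valued_hom_separates s t : ~~ (s <= t) ->
  exists f, [/\ two_valued_hom f, f s & ~~ f t].
Proof.
move=> nst.
have [F [[FI FS nFt Fs'] Fmax]] := Zorn_bigcup (@filter_avoiding_bigcup s t).
have Fs : F s.
  (* If [s] were not in [F], then [F] would be empty and the principal filter of [s] would properly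
     extend it. *)
  apply: contrapT => nFs; apply: (Fmax [set x | s <= x]%classic).
    split; first by move=> x Fx; case: nFs; exact: Fs' Fx.
    by move=> /(_ s); rewrite /= lexx => /(_ isT)/nFs.
  split=> //=; last by apply/negP.
  - by move=> x y; rewrite lexI => -> ->.
  - by move=> x y xy /le_trans; exact.
have adjoin x : ~ F x -> exists2 a, F a & a `&` x <= t.
  move=> nFx; apply: contrapT => notin.
  (* The filter generated by [F] and [x] is strictly larger than [F], so by maximality it must
     contain [t]. *)
  apply: (Fmax [set y | exists2 a, F a & (a `&` x <= y)%O]%classic).
    split; first by move=> y Fy; exists y => //; exact: leIl.
    by move=> /(_ x) Fx; apply/nFx/Fx; exists s => //; exact: leIr.
  split=> //=; last by exists s => //; exact: leIl.
  - move=> y z [a Fa ay] [b Fb bz]; exists (a `&` b); first exact: FI.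
    by rewrite lexI (le_trans _ ay) ?(le_trans _ bz) // leI2 ?leIl ?leIr.
  - by move=> y z yz [a Fa ay]; exists a => //; exact: le_trans yz.
have F_total x : F x \/ F x^*.
  apply: contrapT => /not_orP[/adjoin[a Fa ax] /adjoin[b Fb bx]].
  apply/nFt/(FS (a `&` b)); last exact: FI.
  (* The join of [x] and [x^*] is above everything, so distributivity splits the meet of [a] and [b]
     into two parts, each below [t]. *)
  rewrite -(meet_l (le_join_sepinv x (a `&` b))) meetC distU leUx.
  rewrite (le_trans _ ax) ?(le_trans _ bx) // lexI.
  - by rewrite leIl leIxr // leIr.
  - by rewrite leIl leIxr // leIl.
have F_inv x : F x^* <-> ~ F x.
  split=> [Fx' Fx|]; last by case: (F_total x).
  by apply/nFt/(FS _ _ (meet_sepinv_le x t)); exact: FI.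
have F_meet x y : F (x `&` y) <-> F x /\ F y.
  by split=> [Fxy|[]]; [split; apply: FS Fxy; rewrite ?leIl ?leIr | exact: FI].
exists (fun x => `[< F x >]); split; [split|exact/asboolP|exact/asboolPn].
- by move=> x; rewrite -asbool_neg; exact: asbool_equiv_eq.
(* Joins reduce to meets and inverses by De Morgan. *)
- move=> x y; rewrite -[x `|` y]sepinvK sepinv_join (asbool_equiv_eq (F_inv _)).
  rewrite asbool_neg (asbool_equiv_eq (F_meet _ _)) asbool_and.
  by rewrite !(asbool_equiv_eq (F_inv _)) !asbool_neg negb_and !negbK.
- by move=> x y; rewrite (asbool_equiv_eq (F_meet _ _)) asbool_and.
Qed.

End Separation.

Definition stone_space : Type := {f : U -> bool | two_valued_hom f}.

Lemma stone_setsep_subproof s :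
  `[< ([set f : stone_space | sval f s] `|` [set f : stone_space | ~~ sval f s]
       = [set: stone_space])%classic >].
Proof.
by apply/asboolP/seteqP; split=> //= f _ /=; case: (sval f s); [left|right].
Qed.

Definition stone_setsep s : setsep stone_space :=
  SetSep (sides := ([set f : stone_space | sval f s],
                    [set f : stone_space | ~~ sval f s])%classic)
         (stone_setsep_subproof s).

Lemma stone_setsep_bipartition s : stone_setsep s \in bipartitions stone_space.
Proof. by apply/asboolP; rewrite -subset0 => f /= [-> ]. Qed.

Definition stone_map s : UB stone_space :=
  SubUniverseElt (stone_setsep_bipartition s).

Lemma stone_map_hom : universe_hom stone_map.
Proof.
split=> [s|s t|s t]; apply/val_inj/val_inj => /=;
  congr pair; apply/seteqP; split=> -[f [fV fU fI]] /=;
  rewrite ?fV ?fU ?fI ?negbK ?negb_or ?negb_and;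
  by [|move=> /orP|case=> ->; rewrite ?orbT|move=> /andP|case=> -> ->].
Qed.

(** A homomorphism true at [s] and false at [t] is a point of the first side for [s] but not for
    [t], so equal images force [s <= t] and, by symmetry, equality. *)
Lemma stone_map_inj :
  distributive U -> fastidious U -> injective stone_map.
Proof.
move=> distU fastU.
suff le_stone s t : stone_map s = stone_map t -> s <= t.
  by move=> s t st; apply/le_anti; rewrite !le_stone.
move=> /(congr1 (fun b => (sides (val b)).1)) /= st.
apply: contrapT => /negP /(two_valued_hom_separates distU fastU)[f [hf fs]].
have : [set g : stone_space | sval g s]%classic (exist _ f hf) by [].
by rewrite st /= => ->.
Qed.

End SeparationUniverses.

Section HomImage.
Context (d d' : Order.disp_t) (U : sepUniverseType d) (W : sepUniverseType d').

(** The argument [homf] is carried in the predicate so that the closure instances, which depend on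
    it, can be inferred. *)
Definition hom_image (f : U -> W) (homf : universe_hom f) : {pred W} :=
  fun w => `[< exists s, f s = w >].

Context (f : U -> W) (homf : universe_hom f).

Lemma hom_image_inv_closed w : w \in hom_image homf -> w^* \in hom_image homf.
Proof.
have [fV _ _] := homf; move=> /asboolP[s <-].
by apply/asboolP; exists s^*; rewrite fV.
Qed.

Lemma hom_image_join_closed :
  {in hom_image homf &, forall w x, w `|` x \in hom_image homf}.
Proof.
have [_ fU _] := homf; move=> w x /asboolP[s <-] /asboolP[t <-].
by apply/asboolP; exists (s `|` t); rewrite fU.
Qed.

Lemma hom_image_meet_closed :
  {in hom_image homf &, forall w x, w `&` x \in hom_image homf}.
Proof.
have [_ _ fI] := homf; move=> w x /asboolP[s <-] /asboolP[t <-].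
by apply/asboolP; exists (s `&` t); rewrite fI.
Qed.

HB.instance Definition _ := Order.isLatticeClosed.Build d' W
  (hom_image homf) hom_image_meet_closed hom_image_join_closed.
HB.instance Definition _ := isSepinvClosed.Build d' W
  (hom_image homf) hom_image_inv_closed.

Lemma hom_image_isomorphic :
  injective f -> universe_isomorphic (sub_universe (hom_image homf)) U.
Proof.
move=> injf; have [fV fU fI] := homf.
have imP (w : sub_universe (hom_image homf)) : exists s, f s = val w.
  exact/asboolP/(valP w).
have im s : f s \in hom_image homf by apply/asboolP; exists s.
(* The inverse picks a preimage by choice; injectivity of [f] makes it a homomorphism. *)
pose h w := sval (cid (imP w)).
have hK w : f (h w) = val w := svalP (cid (imP w)).
exists h, (fun s => SubUniverseElt (im s)); split.
- by move=> w; apply: val_inj; exact: hK.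
- by move=> s; apply: injf; exact: hK.
- by split=> [w|w x|w x]; apply: injf; rewrite ?fV ?fU ?fI !hK.
- by split=> [s|s t|s t]; apply: val_inj => /=.
Qed.

End HomImage.

Section Pullback.
Context (d d' : Order.disp_t) (U : sepUniverseType d) (W : sepUniverseType d').
Context (f : U -> W) (homf : universe_hom f) (injf : injective f).

(** The order is an equation between meets, which an injective homomorphism preserves and
    reflects. *)
Lemma le_universe_hom s t : (f s <= f t) = (s <= t).
Proof. by have [_ _ fI] := homf; rewrite !leEmeet -fI (inj_eq injf). Qed.

Lemma distributive_pullback : distributive W -> distributive U.
Proof.
have [_ fU fI] := homf; move=> distW s t u.
by apply: injf; rewrite !(fU, fI) distW.
Qed.

Lemma fastidious_pullback : fastidious W -> fastidious U.
Proof.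
have [fV _ _] := homf; move=> fastW s ss t; rewrite -le_universe_hom.
by apply: fastW; rewrite /small -fV le_universe_hom.
Qed.

End Pullback.

Lemma sub_universe_val_hom d (U : sepUniverseType d) (S : subUniverse U) :
  universe_hom (val : sub_universe S -> U).
Proof. by []. Qed.

(** Meet and join swap roles on second sides, so the two coordinates use dual distributive laws of
    sets. *)
Lemma UB_distributive V : distributive (UB V).
Proof.
move=> s t u; apply/val_inj/val_inj => /=.
by congr pair; [exact: setIUl | exact: setUIl].
Qed.

(** A small bipartition has its first side inside the disjoint second one, so it is the empty set
    paired with [V], the bottom element. *)
Lemma UB_fastidious V : fastidious (UB V).
Proof.
move=> s; rewrite /small -Order.le_val => ss t; rewrite -Order.le_val.
(* The involution swaps sides, so both inclusions in [s <= s^*] are the same. *)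
have [s12 _] : ((sides (val s)).1 `<=` (sides (val s)).2)%classic /\
  ((sides (val s)).1 `<=` (sides (val s)).2)%classic := asboolW ss.
have /asboolP s0 := valP s.
have s1 : ((sides (val s)).1 = set0)%classic.
  by rewrite -s0; apply/esym/setIidPl.
have s2 : ((sides (val s)).2 = setT)%classic.
  by have := sidesP (val s); rewrite s1 set0U.
apply: (introT (asboolP _)); rewrite s1 s2.
by split; [exact: sub0set | exact: subsetT].
Qed.

Theorem theorem3p8 (d : Order.disp_t) (U : sepUniverseType d) :
  strongly_implementable_by_bipartitions U <-> distributive U /\ fastidious U.
Proof.
split=> [[V [S [f [g [_ gf _ homg]]]]]|[distU fastU]].
(* Both properties are pulled back along [val] from [UB V] to [S], then along [g] to [U]. *)
- have injg := can_inj gf.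
  have homv := sub_universe_val_hom S.
  split.
  + apply: (distributive_pullback homg injg).
    exact: (distributive_pullback homv val_inj (@UB_distributive V)).
  + apply: (fastidious_pullback homg injg).
    exact: (fastidious_pullback homv val_inj (@UB_fastidious V)).
- exists (stone_space U).
  (* Unification finds the sub-universe: the image of [stone_map]. *)
  eexists; exact: (hom_image_isomorphic (stone_map_hom U)
                                        (stone_map_inj distU fastU)).
Qed.
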